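(* Let $S$ be an object of $\mathbf{Met}$ (respectively, of $\mathbf{Met}_\infty$). Then $S$ is a co-Mal'tsev object in $\mathbf{Met}$ (respectively, in $\mathbf{Met}_\infty$) if and only if $S$ is an ultrametric space.
   Context: $\mathbf{Met}$ is the category whose objects are metric spaces and whose morphisms are short maps, i.e. maps $f:X\to Y$ with $d(f(x_1),f(x_2))\leqslant d(x_1,x_2)$ for all $x_1,x_2\in X$. $\mathbf{Met}_\infty$ is the category whose objects are extended metric spaces (sets with a distance function taking values in $\mathbb{R}\cup\{\infty\}$ and satisfying the axioms for a metric) and whose morphisms are short maps. The empty space is allowed. An (extended) metric space is an ultrametric space if $d(x,z)\leqslant\max\{d(x,y),d(y,z)\}$ for all points $x,y,z$. An internal relation from $X$ to $Y$ in a category $\mathbb{C}$ is a triple $(R,r_1,r_2)$ where $r_1:R\to X$ and $r_2:R\to Y$ are jointly monomorphic morphisms of $\mathbb{C}$. For an object $S$ and morphisms $f:S\to X$, $g:S\to Y$, write $fRg$ if there is $h:S\to R$ with $r_1h=f$ and $r_2h=g$. An object $S$ of $\mathbb{C}$ is a Mal'tsev object if for all objects $X,Y$, every internal relation $(R,r_1,r_2)$ from $X$ to $Y$ and all morphisms $x_1,x_2:S\to X$ and $y_1,y_2:S\to Y$: if $x_1Ry_2$, $x_2Ry_2$ and $x_2Ry_1$, then $x_1Ry_1$. An object of $\mathbb{C}$ is a co-Mal'tsev object if it is a Mal'tsev object of the dual category $\mathbb{C}^{\mathrm{op}}$. *)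

(* Defs.v *)
From HB Require Import structures.
From mathcomp Require Import all_boot all_order all_algebra.
From mathcomp Require Import all_classical all_reals topology.

Set Implicit Arguments.
Unset Strict Implicit.
Unset Printing Implicit Defensive.

Import Order.TTheory GRing.Theory Num.Theory.
Local Open Scope ring_scope.

Record category := Category {
  obj :> Type;
  hom : obj -> obj -> Type;
  idc : forall X, hom X X;
  comp : forall X Y Z, hom Y Z -> hom X Y -> hom X Z;
  comp_idl : forall X Y (f : hom X Y), comp (idc Y) f = f;
  comp_idr : forall X Y (f : hom X Y), comp f (idc X) = f;
  compA : forall X Y Z W (h : hom Z W) (g : hom Y Z) (f : hom X Y),
    comp h (comp g f) = comp (comp h g) f }.

Arguments hom {c} X Y.
Arguments idc {c} X.
Arguments comp {c X Y Z} g f.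

Definition op (C : category) : category := {|
  obj := C;
  hom := fun X Y => @hom C Y X;
  idc := fun X => idc X;
  comp := fun X Y Z g f => @comp C Z Y X f g;
  comp_idl := fun X Y f => @comp_idr C Y X f;
  comp_idr := fun X Y f => @comp_idl C Y X f;
  compA := fun X Y Z W h g f => esym (@compA C W Z Y X f g h) |}.

Definition jointly_monic (C : category) (R X Y : C) (r1 : hom R X)
    (r2 : hom R Y) : Prop :=
  forall (T : C) (u v : hom T R),
    comp r1 u = comp r1 v -> comp r2 u = comp r2 v -> u = v.

Record internal_relation (C : category) (X Y : C) := InternalRelation {
  rel_obj : C;
  rel_fst : hom rel_obj X;
  rel_snd : hom rel_obj Y;
  rel_monic : jointly_monic rel_fst rel_snd }.

Definition related (C : category) (X Y : C) (R : internal_relation X Y) (S : C)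
    (f : hom S X) (g : hom S Y) : Prop :=
  exists h : hom S (rel_obj R), comp (rel_fst R) h = f /\ comp (rel_snd R) h = g.

Definition maltsev_object (C : category) (S : C) : Prop :=
  forall (X Y : C) (R : internal_relation X Y)
    (x1 x2 : hom S X) (y1 y2 : hom S Y),
  related R x1 y2 -> related R x2 y2 -> related R x2 y1 -> related R x1 y1.

Definition co_maltsev_object (C : category) (S : C) : Prop :=
  @maltsev_object (op C) S.

(* The next two notions are generic in the ordered type V of distances, so that
   they cover both real-valued and extended real-valued metrics. *)
Definition short_map {disp : Order.disp_t} {V : porderType disp} {X Y : Type}
    (dX : X -> X -> V) (dY : Y -> Y -> V) (f : X -> Y) : Prop :=
  forall x1 x2 : X, (dY (f x1) (f x2) <= dX x1 x2)%O.

Definition ultrametric {disp : Order.disp_t} {V : orderType disp} {X : Type}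
    (d : X -> X -> V) : Prop :=
  forall x y z : X, (d x z <= Order.max (d x y) (d y z))%O.

Lemma short_map_id {disp : Order.disp_t} {V : porderType disp} {X : Type}
  (dX : X -> X -> V) : short_map dX dX id.
Proof. by move=> x1 x2 /=. Qed.

Lemma short_map_comp {disp : Order.disp_t} {V : porderType disp} {X Y Z : Type}
  (dX : X -> X -> V) (dY : Y -> Y -> V) (dZ : Z -> Z -> V)
  (g : Y -> Z) (f : X -> Y) :
  short_map dY dZ g -> short_map dX dY f -> short_map dX dZ (g \o f).
Proof. by move=> gP fP x1 x2 /=; apply: le_trans (fP x1 x2). Qed.

(* The category of short maps between the spaces (carrier i, dist i), i : I. *)
Section ShortCategory.
Context {disp : Order.disp_t} {V : porderType disp}.
Context (I : Type) (carrier : I -> Type).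
Context (dist : forall i, carrier i -> carrier i -> V).

Definition short_hom (X Y : I) : Type :=
  {f : carrier X -> carrier Y | short_map (@dist X) (@dist Y) f}.

Definition short_id (X : I) : short_hom X X :=
  exist _ id (short_map_id (@dist X)).

Definition short_comp (X Y Z : I) (g : short_hom Y Z) (f : short_hom X Y) :
    short_hom X Z :=
  exist _ (sval g \o sval f) (short_map_comp (svalP g) (svalP f)).

Lemma short_comp_idl X Y (f : short_hom X Y) : short_comp (short_id Y) f = f.
Proof. by case: f => f fP; apply: eq_exist. Qed.

Lemma short_comp_idr X Y (f : short_hom X Y) : short_comp f (short_id X) = f.
Proof. by case: f => f fP; apply: eq_exist. Qed.

Lemma short_compA X Y Z W (h : short_hom Z W) (g : short_hom Y Z)
    (f : short_hom X Y) :
  short_comp h (short_comp g f) = short_comp (short_comp h g) f.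
Proof. exact: eq_exist. Qed.

Definition short_category : category :=
  Category short_comp_idl short_comp_idr short_compA.

End ShortCategory.

(* A metricType carries, besides its distance, the topology and uniformity that
   the distance generates; its carrier may be empty. *)
Definition Met (R : realType) : category :=
  short_category (fun X : metricType R => @mdist R X).

(* Distinct from the extended distance edist that the library derives from the
   balls of a pseudometric space: here the distance is part of the structure. *)
Record emetricType (R : realType) := EMetric {
  epoint :> Type;
  emdist : epoint -> epoint -> \bar R;
  emdist_ge0 : forall x y, (0 <= emdist x y)%E;
  emdist_eq0 : forall x y, emdist x y = 0%E <-> x = y;
  emdist_sym : forall x y, emdist x y = emdist y x;
  emdist_triangle : forall x y z, (emdist x z <= emdist x y + emdist y z)%E }.

Definition Met_infty (R : realType) : category :=
  short_category (fun X : emetricType R => @emdist R X).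

(* Main.v *)
(** Jointly epic short maps have dense joint image:
    a tent function of small radius around a point away from the image and the
    constant [0] agree on the image. Hence, given [r1 : X -> T], [r2 : Y -> T]
    jointly epic and three short maps [u12], [u22], [u21 : T -> S] restricting to
    [(x1, y2)], [(x2, y2)], [(x2, y1)], one glues [u12] on the closure of the
    image of [r1] with [u21] elsewhere. If [S] is an ultrametric space, then for
    [p] in the first closure and [q] in the closure of the image of [r2], the
    three-step path u12 p, u12 q = u22 q, u22 p = u21 p, u21 q shows that the
    glued map is short. Conversely, when [T] consists of two points at distance
    [max (d x y) (d y z)], the three maps [(x, y)], [(y, y)], [(y, z)] are short,
    and the shortness of [(x, z)] is the ultrametric inequality. *)
From HB Require Import structures.
From mathcomp Require Import all_boot all_order all_algebra.
From mathcomp Require Import all_classical all_reals topology.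
From mathcomp Require Import interval_inference lra.
Require Import Defs.

Set Implicit Arguments.
Unset Strict Implicit.
Unset Printing Implicit Defensive.

Import Order.TTheory GRing.Theory Num.Theory.
Local Open Scope classical_set_scope.
Local Open Scope ring_scope.

Section ExtendedMetric.
Context {R : realType}.
Implicit Types (S T : emetricType R) (M : metricType R).

Lemma emdistxx T (x : T) : emdist x x = 0%E.
Proof. exact/emdist_eq0. Qed.

Definition adherent T (A : set T) : set T :=
  [set p | forall eps : R, 0 < eps -> exists2 q, A q & (emdist p q < eps%:E)%E].

Lemma subset_adherent T (A : set T) : A `<=` adherent A.
Proof. by move=> p Ap eps eps0; exists p => //; rewrite emdistxx lte_fin. Qed.

(** If a ball of radius [del] about [p] misses [A], then every ball of radius at most [del] that
    meets the union meets [B]. *)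
Lemma adherentU T (A B : set T) : adherent (A `|` B) `<=` adherent A `|` adherent B.
Proof.
move=> p pAB; apply/or_asboolP; rewrite -implyNb; apply/implyP => /asboolPn nA.
apply/asboolP => eps eps0.
have [del [del0 nAdel]] : exists del : R,
    0 < del /\ forall q, A q -> ~ (emdist p q < del%:E)%E.
  apply: contrapT => H; apply: nA => del del0; apply: contrapT => H'.
  by apply: H; exists del; split=> // q Aq pq; apply: H'; exists q.
have [|q [Aq|Bq] pq] := pAB (Num.min eps del).
- by rewrite lt_min eps0.
- by case: (nAdel q Aq); rewrite (lt_le_trans pq)// lee_fin ge_min lexx orbT.
- by exists q => //; rewrite (lt_le_trans pq)// lee_fin ge_min lexx.
Qed.

(** Shortness puts [u p] and [v p] within [eps / 2] of the common value [u q = v q] at some [q] in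
    [A] close to [p]. *)
Lemma short_eq_adherent S T (u v : T -> S) (A : set T) :
  short_map (@emdist R T) (@emdist R S) u ->
  short_map (@emdist R T) (@emdist R S) v ->
  {in A, u =1 v} -> {in adherent A, u =1 v}.
Proof.
move=> us vs uv p /set_mem pA; apply/emdist_eq0/eqP.
rewrite eq_le emdist_ge0 andbT; apply/lee_addgt0Pr => eps eps0; rewrite add0e.
have [|q /mem_set/uv uvq pq] := pA (eps / 2); first by rewrite divr_gt0.
rewrite (le_trans (emdist_triangle _ (u q) _))// [eps]splitr EFinD leeD//.
  exact: le_trans (us _ _) (ltW pq).
by rewrite uvq emdist_sym (le_trans (vs _ _) (ltW pq)).
Qed.

Lemma metric_emdist_ge0 M (x y : M) : (0 <= (mdist x y)%:E)%E.
Proof. by rewrite lee_fin mdist_ge0. Qed.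

Lemma metric_emdist_eq0 M (x y : M) : (mdist x y)%:E = 0%E <-> x = y.
Proof. by split=> [[/mdist_positivity]|->]; rewrite ?mdistxx. Qed.

Lemma metric_emdist_sym M (x y : M) : (mdist x y)%:E = (mdist y x)%:E.
Proof. by rewrite metric_sym. Qed.

Lemma metric_emdist_triangle M (x y z : M) :
  ((mdist x z)%:E <= (mdist x y)%:E + (mdist y z)%:E)%E.
Proof. by rewrite -EFinD lee_fin metric_triangle. Qed.

Definition emetric_of_metric M : emetricType R :=
  EMetric (@metric_emdist_ge0 M) (@metric_emdist_eq0 M) (@metric_emdist_sym M)
    (@metric_emdist_triangle M).

(** Infinite distance gets 0, the value already taken at finite distances beyond [eps]. *)
Definition tent T (eps : R) (p q : T) : R :=
  if emdist p q is r%:E then Num.max 0 (eps - r) else 0.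

Lemma tent_short T (eps : R) (p : T) :
  short_map (@emdist R T) (@emdist R (emetric_of_metric R^o)) (tent eps p).
Proof.
move=> q1 q2; rewrite /tent /=.
have := emdist_triangle p q1 q2; have := emdist_triangle p q2 q1.
have := emdist_ge0 q1 q2; rewrite (emdist_sym q2 q1) /mdist/=.
(* If just one of the distances to [p] is infinite, the triangle inequality makes [emdist q1 q2]
   infinite and the bound trivial. *)
case: (emdist p q1) (emdist_ge0 p q1) => [r1| |]//;
  case: (emdist p q2) (emdist_ge0 p q2) => [r2| |]//;
  case: (emdist q1 q2) => [r| |]//=; rewrite ?leey ?lee_fin ?subrr ?normr0//.
move=> r2_ge0 r1_ge0 r_ge0 t12 t21.
rewrite ler_norml !maxEle; do 2!case: ifP; lra.
Qed.

Lemma exists_separating_short T (A : set T) (p : T) : ~ adherent A p ->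
  exists u v : T -> emetric_of_metric R^o,
    [/\ short_map (@emdist R T) (@emdist R _) u,
        short_map (@emdist R T) (@emdist R _) v,
        {in A, u =1 v} & u p <> v p].
Proof.
move=> /existsNP[eps /not_implyP[eps0 far]].
exists (tent eps p), (fun=> 0); split; first exact: tent_short.
- by move=> q1 q2; rewrite emdistxx emdist_ge0.
- move=> q /set_mem Aq; rewrite /tent.
  have : (eps%:E <= emdist p q)%E.
    by rewrite leNgt; apply/negP => pq; apply: far; exists q.
  case: (emdist p q) => [r| |]//; rewrite lee_fin => epsr.
  by rewrite max_l// subr_le0.
- by rewrite /tent emdistxx /= subr0 max_r ?ltW//; apply/eqP; rewrite gt_eqF.
Qed.

(* The radius is a parameter of the type so that each [m] gets its own
   canonical metric. *)
Definition two_points (m : {posnum R}) : Type := bool.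

HB.instance Definition _ m := Choice.on (two_points m).

Section TwoPoints.
Variable m : {posnum R}.

Let dist (s t : two_points m) : R := if s == t then 0 else m%:num.

Let dist_refl s : dist s s = 0.
Proof. by rewrite /dist eqxx. Qed.

Let dist_positivity s t : dist s t = 0 -> s = t.
Proof. by rewrite /dist; case: eqP => // _ /eqP; rewrite gt_eqF. Qed.

Let dist_sym s t : dist s t = dist t s.
Proof. by rewrite /dist eq_sym. Qed.

Let dist_triangle t s r : dist s r <= dist s t + dist t r.
Proof.
rewrite /dist; case: (s =P t) => [->|_]; first by rewrite add0r.
by case: (t =P r) => _; case: ifP => _; rewrite ?addr0 ?addr_ge0 ?lerDl.
Qed.

HB.instance Definition _ := isMetric.Build R (two_points m)
  dist_refl dist_positivity dist_sym dist_triangle.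

End TwoPoints.

End ExtendedMetric.

(* Both [Met R] and [Met_infty R] are instances: [V] is the type in which their
   distances are valued and [e] its embedding in [\bar R]. *)
Section CoMaltsev.
Context {R : realType} {disp : Order.disp_t} {V : orderType disp}.
Context (e : V -> \bar R).
Context (I : Type) (space : I -> emetricType R).
Context (dist : forall i, space i -> space i -> V).
Context (of_metric : metricType R -> I).
Hypothesis e_mono : forall a b, (e a <= e b)%O = (a <= b)%O.
Hypothesis e_dist : forall i (x y : space i), e (dist x y) = emdist x y.
Hypothesis of_metricE : forall M, space (of_metric M) = emetric_of_metric M.

Let C : category := short_category dist.

Lemma short_map_emdist i j (f : space i -> space j) :
  short_map (@dist i) (@dist j) f <->
  short_map (@emdist R (space i)) (@emdist R (space j)) f.
Proof. by split=> fs x y; have := fs x y; rewrite -e_mono !e_dist. Qed.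

Lemma short_hom_ext i j (f g : @hom C i j) : sval f =1 sval g -> f = g.
Proof. by case: f g => [f fs] [g gs] /= /funext fg; apply: eq_exist. Qed.

Lemma short_hom_emdist i j (f : @hom C i j) :
  short_map (@emdist R (space i)) (@emdist R (space j)) (sval f).
Proof. exact/short_map_emdist/(svalP f). Qed.

Lemma ultrametric_emdist i :
  ultrametric (@dist i) <-> ultrametric (@emdist R (space i)).
Proof.
split=> ult x y z; have := ult x y z; rewrite !le_max.
  by rewrite -!e_mono !e_dist.
by rewrite -!e_dist !e_mono.
Qed.

Lemma comp_apply i j k (g : @hom C j k) (f : @hom C i k) (r : @hom C i j) :
  comp g r = f -> forall x, sval g (sval r x) = sval f x.
Proof. by move=> <-. Qed.

(** The separating maps land in the real line, a genuine metric space, which [of_metric] turns into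
    an object of [C]. *)
Lemma jointly_epic_dense i j k (r1 : @hom C i k) (r2 : @hom C j k) :
  @jointly_monic (op C) k i j r1 r2 ->
  forall p, adherent (range (sval r1) `|` range (sval r2)) p.
Proof.
move=> epi p; apply: contrapT => /exists_separating_short.
rewrite -of_metricE => -[u [v [/short_map_emdist us /short_map_emdist vs uv]]].
have e1 : @comp C _ _ _ (exist _ u us) r1 = comp (exist _ v vs : @hom C _ _) r1.
  by apply: short_hom_ext => x /=; apply/uv/mem_set; left; exists x.
have e2 : @comp C _ _ _ (exist _ u us) r2 = comp (exist _ v vs : @hom C _ _) r2.
  by apply: short_hom_ext => x /=; apply/uv/mem_set; right; exists x.
by have /(congr1 sval)/= -> := epi _ _ _ e1 e2.
Qed.

Lemma ultrametric_glue (S T X Y : I) (r1 : @hom C X T) (r2 : @hom C Y T)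
    (x1 x2 : @hom C X S) (y1 y2 : @hom C Y S) (u12 u22 u21 : @hom C T S) :
  ultrametric (@dist S) -> @jointly_monic (op C) T X Y r1 r2 ->
  comp u12 r1 = x1 -> comp u12 r2 = y2 ->
  comp u22 r1 = x2 -> comp u22 r2 = y2 ->
  comp u21 r1 = x2 -> comp u21 r2 = y1 ->
  exists h : @hom C T S, comp h r1 = x1 /\ comp h r2 = y1.
Proof.
move=> /ultrametric_emdist ult epi u12x u12y u22x u22y u21x u21y.
(* By density the closures of the two images cover [T]. *)
have A p := adherentU (jointly_epic_dense epi p).
have eqX : {in adherent (range (sval r1)), sval u22 =1 sval u21}.
  apply: short_eq_adherent; try exact: short_hom_emdist.
  by move=> _ /set_mem[a _ <-]; rewrite (comp_apply u22x) (comp_apply u21x).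
have eqY : {in adherent (range (sval r2)), sval u12 =1 sval u22}.
  apply: short_eq_adherent; try exact: short_hom_emdist.
  by move=> _ /set_mem[b _ <-]; rewrite (comp_apply u12y) (comp_apply u22y).
pose inX (p : space T) := `[< adherent (range (sval r1)) p >].
pose h p := if inX p then sval u12 p else sval u21 p.
have inXP p : inX p -> p \in adherent (range (sval r1)).
  by move=> /asboolP/mem_set.
have NinX p : ~~ inX p -> p \in adherent (range (sval r2)).
  by move=> /asboolPn nX; apply/mem_set; case: (A p).
(* Each leg of the path has length at most [emdist p q]; the ultrametric inequality bounds the whole
   by the longest leg, not by the sum. *)
have mixed p q : inX p -> ~~ inX q ->
    (emdist (sval u12 p) (sval u21 q) <= emdist p q)%E.
  move=> pX qY; rewrite (le_trans (ult _ (sval u12 q) _))// ge_max.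
  rewrite (short_hom_emdist u12)/= (eqY _ (NinX _ qY)).
  rewrite (le_trans (ult _ (sval u22 p) _))// ge_max emdist_sym.
  rewrite (short_hom_emdist u22)/= (eqX _ (inXP _ pX)).
  exact: (short_hom_emdist u21).
have hs : short_map (@dist T) (@dist S) h.
  apply/short_map_emdist => p q; rewrite /h.
  case: ifPn => pX; case: ifPn => qX.
  - exact: (short_hom_emdist u12).
  - exact: mixed.
  - by rewrite emdist_sym [leRHS]emdist_sym mixed.
  - exact: (short_hom_emdist u21).
exists (exist _ h hs); split; apply: short_hom_ext => a /=; rewrite /h.
- have -> : inX (sval r1 a).
    by apply/asboolP; apply: subset_adherent; exists a.
  exact: (comp_apply u12x).
(* Where the closures overlap, [u12], [u22] and [u21] all agree, so the choice of [u12] there does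
   no harm. *)
- rewrite -(comp_apply u21y); case: ifPn => // aX.
  rewrite -(eqX _ (inXP _ aX)); apply/eqY/mem_set/subset_adherent.
  by exists a.
Qed.

Lemma ultrametric_co_maltsev (S : I) :
  ultrametric (@dist S) -> @co_maltsev_object C S.
Proof.
move=> ult X Y [T r1 r2 epi] x1 x2 y1 y2.
move=> [u12 [u12x u12y]] [u22 [u22x u22y]] [u21 [u21x u21y]].
exact: (ultrametric_glue ult epi u12x u12y u22x u22y u21x u21y).
Qed.

(** The existential form hides the transport along the propositional equality [of_metricE]. *)
Lemma exists_two_point_space (m : {posnum R}) :
  exists i (t0 t1 : space i), [/\ t0 <> t1, emdist t0 t1 = m%:num%:E &
    forall t : space i, t = t0 \/ t = t1].
Proof.
exists (of_metric (two_points m)); rewrite of_metricE.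
by exists false, true; split=> // -[]; [right|left].
Qed.

Lemma co_maltsev_ultrametric (S : I) :
  @co_maltsev_object C S -> ultrametric (@dist S).
Proof.
move=> coM; apply/ultrametric_emdist => x y z.
case E : (Order.max (emdist x y) (emdist y z)) => [m| |]; last first.
- have : (0 <= Order.max (emdist x y) (emdist y z))%E by rewrite le_max emdist_ge0.
  by rewrite E.
- exact: leey.
have xym : (emdist x y <= m%:E)%E by rewrite -E le_max lexx.
have yzm : (emdist y z <= m%:E)%E by rewrite -E le_max lexx orbT.
have : 0 <= m by rewrite -lee_fin (le_trans (emdist_ge0 x y)).
(* Distinct points cannot be at distance 0, so [m = 0] is treated apart: it forces [x = y]. *)
rewrite le_eqVlt => /predU1P[m0|m0].
  rewrite -m0 in xym yzm *.
  have /emdist_eq0 -> : emdist x y = 0%E.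
    by apply/eqP; rewrite eq_le emdist_ge0 andbT.
  exact: yzm.
have [T [t0 [t1 [t01 dt tE]]]] := exists_two_point_space (PosNum m0).
pose pick (a b : space S) (t : space T) := if `[< t = t0 >] then a else b.
have pick0 a b : pick a b t0 = a by rewrite /pick asboolT.
have pick1 a b : pick a b t1 = b by rewrite /pick asboolF//; exact: nesym.
have pick_short a b : (emdist a b <= m%:E)%E ->
    short_map (@dist T) (@dist S) (pick a b).
  move=> abm; apply/short_map_emdist => s t.
  case: (tE s) => ->; case: (tE t) => ->; rewrite ?pick0 ?pick1 ?emdistxx//.
    by rewrite dt.
  by rewrite emdist_sym (emdist_sym t1) dt.
have cst_short i j (a : space j) : short_map (@dist i) (@dist j) (fun=> a).
  by apply/short_map_emdist => s t; rewrite emdistxx emdist_ge0.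
pose cst i j (a : space j) : @hom C i j := exist _ _ (cst_short i j a).
(* Constant legs out of [S] reach [t0] and [t1] because [S] contains [x], and these two points
   exhaust [T]. *)
have epi : @jointly_monic (op C) T S S (cst S T t0) (cst S T t1).
  move=> U u v /= /(congr1 (fun f => sval f x))/= e0.
  move=> /(congr1 (fun f => sval f x))/= e1.
  by apply: short_hom_ext => t; case: (tE t) => ->.
pose rel : @internal_relation (op C) S S := InternalRelation epi.
have relatedP a b : (emdist a b <= m%:E)%E -> related rel (cst S S a) (cst S S b).
  move=> abm; exists (exist _ _ (pick_short _ _ abm)).
  by split; apply: short_hom_ext => s /=; rewrite ?pick0 ?pick1.
(* The related pairs are the constants at [(x, y)], [(y, y)] and [(y, z)]; the resulting [h] sends
   [t0] to [x] and [t1] to [z]. *)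
have [|h [h0 h1]] := coM _ _ rel _ _ _ _ (relatedP _ _ xym) _ (relatedP _ _ yzm).
  by apply: relatedP; rewrite emdistxx lee_fin ltW.
have := short_hom_emdist (h : @hom C T S) t0 t1.
rewrite dt /=.
by rewrite (comp_apply h0 x : sval h t0 = _) (comp_apply h1 x : sval h t1 = _).
Qed.

End CoMaltsev.

Theorem theorem4p3 (R : realType) :
  (forall S : metricType R,
     @co_maltsev_object (Met R) S <-> ultrametric (@mdist R S)) /\
  (forall S : emetricType R,
     @co_maltsev_object (Met_infty R) S <-> ultrametric (@emdist R S)).
Proof.
split=> S; split.
(* For [Met], [EFin] embeds the distances and [of_metric] is the identity; for [Met_infty], [e] is
   the identity and metric spaces are included by [emetric_of_metric]. *)
- exact: (@co_maltsev_ultrametric R _ _ EFin _ (@emetric_of_metric R)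
    (fun X => @mdist R X) id).
- exact: (@ultrametric_co_maltsev R _ _ EFin _ (@emetric_of_metric R)
    (fun X => @mdist R X) id).
- exact: (@co_maltsev_ultrametric R _ _ id _ id
    (fun X => @emdist R X) (@emetric_of_metric R)).
- exact: (@ultrametric_co_maltsev R _ _ id _ id
    (fun X => @emdist R X) (@emetric_of_metric R)).
Qed.
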